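(* For every integer $q\ge1$, set $n:=2q+1$. There exist a fundamental symmetry $J_q\in\mathbb{C}^{n\times n}$ with negative index $q$ and a $J_q$-selfadjoint matrix $A_q\in\mathbb{C}^{n\times n}$ such that $$\sigma(A_q)=\{0\},\qquad d(A_q)=n,\qquad\text{and}\qquad \frac{\mathcal{M}(A_q)}{e\,n\,\mathcal{K}(A_q)}\xrightarrow[q\to\infty]{}1.$$ For every integer $N\ge n$, this pair can be extended to dimension $N$ without changing either $\mathcal{M}$ or $\mathcal{K}$; write $A_{q,N}\in\mathbb{C}^{N\times N}$ for the matrix extending $A_q$ in the extended pair. Hence, for every sequence of integers $N(q)\ge 2q+1$, $$\frac{\mathcal{M}(A_{q,N(q)})}{e\,(2q+1)\,\mathcal{K}(A_{q,N(q)})}\xrightarrow[q\to\infty]{}1.$$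
   Context: A fundamental symmetry is a complex square matrix $J$ with $J=J^*=J^{-1}$; its eigenvalues lie in $\{-1,1\}$, and its negative index is the number of its eigenvalues equal to $-1$, counted with multiplicity. A matrix $A$ of the same size is $J$-selfadjoint if $A^*J=JA$. The ''pair'' in the claim consists of a fundamental symmetry and a matrix selfadjoint with respect to it. $\sigma(A)$ is the spectrum of $A$, and $d(A)$ is the degree of the minimal polynomial of $A$. $\|\cdot\|_2$ is the spectral norm. For a square complex matrix $A$ with spectrum in the closed unit disk, $\mathcal{M}(A):=\sup_{k\ge0}\|A^k\|_2$ is the maximal power growth and $\mathcal{K}(A):=\sup_{|z|>1}(|z|-1)\|(zI-A)^{-1}\|_2$ is the discrete-time Kreiss constant. *)

(* Defs.v *)
From mathcomp Require Import all_boot all_order all_algebra.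
From mathcomp Require Import spectral.
From mathcomp Require Import complex.
From mathcomp Require Import all_classical all_reals all_analysis.
Import Order.TTheory GRing.Theory Num.Theory.
Import numFieldNormedType.Exports.
Import ComplexField.Normc.

Set Implicit Arguments.
Unset Strict Implicit.
Unset Printing Implicit Defensive.

Local Open Scope classical_set_scope.
Local Open Scope ring_scope.
Local Open Scope sesquilinear_scope.

Section Definitions.
Variable R : realType.
Local Notation C := R[i].

(* The invertibility clause is needed because invmx is the identity on
   singular matrices. *)
Definition fundamental_symmetry n (J : 'M[C]_n) : Prop :=
  [/\ J \in unitmx, J = J ^t* & J = invmx J].

(* Algebraic multiplicity of the eigenvalue -1. *)
Definition negative_index n (J : 'M[C]_n) : nat := mup (-1) (char_poly J).

Definition J_selfadjoint n (J A : 'M[C]_n) : Prop := A ^t* *m J = J *m A.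

(* [eigenvalue] uses row vectors, which does not change the spectrum. *)
Definition spectrum n (A : 'M[C]_n) : set C := [set z | eigenvalue A z].

Definition minpoly_degree n (A : 'M[C]_n.+1) : nat := (size (mxminpoly A)).-1.

(* [normc] is the modulus of a complex number, as an element of R. *)
Definition norm2 n (x : 'cV[C]_n) : R :=
  Num.sqrt (\sum_(i < n) normc (x i 0) ^+ 2).

(* Operator norm induced by [norm2]; the supremum is over a nonempty bounded
   set of reals. *)
Definition spectral_norm n (A : 'M[C]_n) : R :=
  sup [set norm2 (A *m x) | x in [set x : 'cV[C]_n | norm2 x <= 1]].

(* [power_growth] and [kreiss_constant] are extended real, since both suprema
   may be infinite. They are meaningful when the spectrum of A lies in the
   closed unit disk; then z%:M - A is invertible whenever |z| > 1. *)
Definition power_growth n (A : 'M[C]_n) : \bar R :=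
  ereal_sup (range (fun k : nat => (spectral_norm (A ^+ k))%:E)).

Definition kreiss_constant n (A : 'M[C]_n) : \bar R :=
  ereal_sup [set ((normc z - 1) * spectral_norm (invmx (z%:M - A)))%:E |
             z in [set z : C | 1 < normc z]].

(* M(A) / (e m K(A)); division in \bar R. *)
Definition kreiss_ratio (m : nat) n (A : 'M[C]_n) : \bar R :=
  (power_growth A / ((expR 1 * m%:R)%:E * kreiss_constant A))%E.

(* A' is the direct sum of A and a block of size N - n. For a pair (J', A') of
   a fundamental symmetry and a J'-selfadjoint matrix, this is the same as
   saying that J' and A' extend J and A as operators from C^n x 0 to C^N: the
   off-diagonal blocks are then forced to vanish. *)
Definition extends n N (A : 'M[C]_n) (A' : 'M[C]_N) : Prop :=
  exists (m : nat) (eN : (n + m)%N = N) (B : 'M[C]_m),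
    A' = castmx (eN, eN) (block_mx A 0 0 B).

End Definitions.

(* Main.v *)
(* Write n = m + 1 = 2q + 1. Take A = g S with S the n x n nilpotent shift, and
   J the flip of the basis, so that A^* J = J A. As g grows, the last power
   A^m, whose only nonzero entry is g^m in the corner, dominates: M(A) = g^m,
   and all entries of (|z| - 1) (z - A)^-1 other than the corner
   (|z| - 1) g^m / z^n are at most g^(m-1) in modulus. Hence K(A) / g^m is close
   to max_(r > 1) (r - 1) / r^n = m^m / n^n, which is asymptotic to 1 / (e n).
   With g = n^4 the error is at most 1 / n^2, so entrywise bounds on the
   spectral norm are enough. *)
Require Import Defs.
From mathcomp Require Import all_boot all_order all_algebra.
From mathcomp Require Import spectral.
From mathcomp Require Import complex ring lra zify.
From mathcomp Require Import all_classical all_reals all_analysis.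
Import Order.TTheory GRing.Theory Num.Theory.
Import numFieldNormedType.Exports.
Import ComplexField.Normc.

Local Open Scope classical_set_scope.
Local Open Scope ring_scope.

Set Implicit Arguments.
Unset Strict Implicit.
Unset Printing Implicit Defensive.

(** * Modulus and Euclidean norm *)

Lemma normc_ge0 (R : realType) (x : R[i]) : 0 <= normc x.
Proof. by case: x => a b; exact: sqrtr_ge0. Qed.

Lemma normcX (R : realType) (x : R[i]) k : normc (x ^+ k) = normc x ^+ k.
Proof.
elim: k => [|k IH]; first by rewrite !expr0 normc1.
by rewrite !exprS normcM IH.
Qed.

Lemma normc_real (R : realType) (a : R) : normc (real_complex R a) = `|a|.
Proof. by rewrite /= expr0n addr0 sqrtr_sqr. Qed.

Lemma ler_normc_sum (R : realType) (I : finType) (F : I -> R[i]) :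
  normc (\sum_i F i) <= \sum_i normc (F i).
Proof.
elim/big_ind2: _ => [|x a y b Hx Hy|//].
  by rewrite normc0.
exact: le_trans (le_normcD _ _) (lerD Hx Hy).
Qed.

Lemma norm2_ge0 (R : realType) n (x : 'cV[R[i]]_n) : 0 <= norm2 x.
Proof. exact: sqrtr_ge0. Qed.

Lemma sqr_norm2 (R : realType) n (x : 'cV[R[i]]_n) :
  norm2 x ^+ 2 = \sum_i normc (x i 0) ^+ 2.
Proof. by rewrite sqr_sqrtr // sumr_ge0 // => i _; exact: sqr_ge0. Qed.

Lemma norm2Z (R : realType) n (a : R[i]) (x : 'cV[R[i]]_n) :
  norm2 (a *: x) = normc a * norm2 x.
Proof.
apply/eqP; rewrite -(eqrXn2 (n := 2)) ?mulr_ge0 ?norm2_ge0 ?normc_ge0 //.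
rewrite exprMn !sqr_norm2 mulr_sumr; apply/eqP/eq_bigr => i _.
by rewrite mxE normcM exprMn.
Qed.

Lemma norm2_col_mx (R : realType) n m (u : 'cV[R[i]]_n) (v : 'cV[R[i]]_m) :
  norm2 (col_mx u v) ^+ 2 = norm2 u ^+ 2 + norm2 v ^+ 2.
Proof.
rewrite !sqr_norm2 big_split_ord /=; congr (_ + _); apply: eq_bigr => i _.
  by rewrite col_mxEu.
by rewrite col_mxEd.
Qed.

Lemma norm2_0 (R : realType) n : norm2 (0 : 'cV[R[i]]_n) = 0.
Proof. by rewrite -(scale0r 0) norm2Z normc0 mul0r. Qed.

Lemma norm2_eq0 (R : realType) n (x : 'cV[R[i]]_n) : norm2 x = 0 -> x = 0.
Proof.
move=> x0; have := sqr_norm2 x; rewrite x0 expr0n /= => /esym/eqP.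
rewrite psumr_eq0 => [/allP H|i _]; last exact: sqr_ge0.
apply/matrixP => i j; rewrite ord1 mxE; apply: eq0_normc.
by apply/eqP; rewrite -sqrf_eq0; apply: H; rewrite mem_index_enum.
Qed.

Lemma norm2_delta (R : realType) n (j : 'I_n) :
  norm2 (delta_mx j 0 : 'cV[R[i]]_n) = 1.
Proof.
apply/eqP; rewrite -(eqrXn2 (n := 2)) ?norm2_ge0 // expr1n sqr_norm2.
rewrite (bigD1 j) //= big1 => [|i ij].
  by rewrite mxE !eqxx normc1 expr1n addr0.
by rewrite mxE (negPf ij) normc0 expr0n.
Qed.

Lemma normc_le_norm2 (R : realType) n (x : 'cV[R[i]]_n) i :
  normc (x i 0) <= norm2 x.
Proof.
rewrite -ler_sqr ?nnegrE ?norm2_ge0 ?normc_ge0 // sqr_norm2.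
by rewrite (bigD1 i) //= lerDl sumr_ge0 // => j _; exact: sqr_ge0.
Qed.

Lemma norm2_le_sum (R : realType) n (x : 'cV[R[i]]_n) :
  norm2 x <= \sum_i normc (x i 0).
Proof.
have sum0 : 0 <= \sum_i normc (x i 0).
  by apply: sumr_ge0 => i _; exact: normc_ge0.
rewrite -ler_sqr ?nnegrE ?norm2_ge0 // sqr_norm2 expr2 mulr_suml.
apply: ler_sum => i _; rewrite expr2 ler_wpM2l ?normc_ge0 //.
rewrite (bigD1 i) //= lerDl sumr_ge0 // => j _; exact: normc_ge0.
Qed.

Lemma norm2_mulmx_le_sum (R : realType) n (A : 'M[R[i]]_n) x :
  norm2 x <= 1 -> norm2 (A *m x) <= \sum_i \sum_j normc (A i j).
Proof.
move=> x1; apply: le_trans (norm2_le_sum _) _; apply: ler_sum => i _.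
rewrite mxE; apply: le_trans (ler_normc_sum _) _; apply: ler_sum => j _.
rewrite normcM ler_piMr ?normc_ge0 //.
exact: le_trans (normc_le_norm2 _ _) x1.
Qed.

(** * The spectral norm as an operator norm *)

Lemma spectral_norm_le (R : realType) n (A : 'M[R[i]]_n) c :
  (forall x, norm2 x <= 1 -> norm2 (A *m x) <= c) -> spectral_norm A <= c.
Proof.
move=> H; apply: ge_sup; last by move=> _ [x x1 <-]; exact: H.
by exists (norm2 (A *m 0)), 0 => //=; rewrite norm2_0 ler01.
Qed.

Lemma norm2_mulmx_le1 (R : realType) n (A : 'M[R[i]]_n) x :
  norm2 x <= 1 -> norm2 (A *m x) <= spectral_norm A.
Proof.
move=> x1; apply: ub_le_sup; last by exists x.
(* The entry sum shows that the set is bounded, so that [sup] is a genuine least upper bound. *)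
exists (\sum_i \sum_j normc (A i j)) => _ [y y1 <-].
exact: norm2_mulmx_le_sum.
Qed.

Lemma spectral_norm_ge0 (R : realType) n (A : 'M[R[i]]_n) :
  0 <= spectral_norm A.
Proof.
apply: le_trans (norm2_mulmx_le1 A (x := 0) _); first exact: norm2_ge0.
by rewrite norm2_0 ler01.
Qed.

Lemma norm2_mulmx (R : realType) n (A : 'M[R[i]]_n) x :
  norm2 (A *m x) <= spectral_norm A * norm2 x.
Proof.
have [/norm2_eq0 ->|x0] := eqVneq (norm2 x) 0.
  by rewrite mulmx0 !norm2_0 mulr0.
have x_gt0 : 0 < norm2 x by rewrite lt0r x0 norm2_ge0.
rewrite -ler_pdivrMr //.
have nE : normc (real_complex R (norm2 x)^-1) = (norm2 x)^-1.
  by rewrite normc_real ger0_norm // invr_ge0 norm2_ge0.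
rewrite mulrC -nE -norm2Z scalemxAr; apply: norm2_mulmx_le1.
by rewrite norm2Z nE mulVf.
Qed.

Lemma normc_le_spectral_norm (R : realType) n (A : 'M[R[i]]_n) i j :
  normc (A i j) <= spectral_norm A.
Proof.
have := norm2_mulmx_le1 A (x := delta_mx j 0); rewrite norm2_delta lexx.
move=> /(_ isT); apply: le_trans; rewrite -colE.
by apply: le_trans (normc_le_norm2 _ i); rewrite mxE.
Qed.

Lemma spectral_norm_le_sum (R : realType) n (A : 'M[R[i]]_n) :
  spectral_norm A <= \sum_i \sum_j normc (A i j).
Proof. by apply: spectral_norm_le => x; exact: norm2_mulmx_le_sum. Qed.

(** * Direct sums with a scalar block *)

(** Squared norms add over the two blocks, and each block expands by at most [spectral_norm A].
    Conversely, padding a vector with zeros recovers the action of [A]. *)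
Lemma spectral_norm_block_scalar (R : realType) n m (A : 'M[R[i]]_n)
    (b : R[i]) :
  normc b <= spectral_norm A ->
  spectral_norm (block_mx A 0 0 (b%:M : 'M[R[i]]_m)) = spectral_norm A.
Proof.
move=> bA; apply/eqP; rewrite eq_le; apply/andP; split.
  apply: spectral_norm_le => x x1; rewrite -(vsubmxK x) mul_block_col.
  rewrite !mul0mx addr0 add0r mul_scalar_mx.
  rewrite -ler_sqr ?nnegrE ?norm2_ge0 ?spectral_norm_ge0 // norm2_col_mx.
  apply: (@le_trans _ _ (spectral_norm A ^+ 2 * norm2 x ^+ 2)).
    rewrite -{3}(vsubmxK x) norm2_col_mx mulrDr norm2Z -!exprMn.
    apply: lerD; rewrite lerXn2r ?nnegrE ?mulr_ge0 ?norm2_ge0 ?normc_ge0 //;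
      rewrite ?spectral_norm_ge0 //; first exact: norm2_mulmx.
    by rewrite ler_wpM2r ?norm2_ge0.
  by rewrite ler_piMr ?sqr_ge0 // expr_le1 // norm2_ge0.
apply: spectral_norm_le => x x1.
have n2E p (u : 'cV[R[i]]_p) : norm2 (col_mx u (0 : 'cV[R[i]]_m)) = norm2 u.
  apply/eqP; rewrite -(eqrXn2 (n := 2)) ?norm2_ge0 //.
  by rewrite norm2_col_mx norm2_0 expr0n addr0.
apply: le_trans (norm2_mulmx_le1 _ (x := col_mx x 0) _); last by rewrite n2E.
by rewrite mul_block_col !mul0mx !mulmx0 !addr0 n2E.
Qed.

Lemma block_scalar_exp (R : realType) n m (A : 'M[R[i]]_n) (b : R[i]) k :
  (block_mx A 0 0 (b%:M : 'M[R[i]]_m)) ^+ k =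
    block_mx (A ^+ k) 0 0 ((b ^+ k)%:M).
Proof.
elim: k => [|k IH]; first by rewrite !expr0 -scalar_mx_block.
rewrite !exprS IH -mulmxE mulmx_block !mulmx0 !mul0mx !addr0 add0r.
by rewrite -scalar_mxM.
Qed.

Lemma power_growth_block0 (R : realType) n m (A : 'M[R[i]]_n.+1) :
  power_growth (block_mx A 0 0 (0 : 'M[R[i]]_m)) = power_growth A.
Proof.
rewrite /power_growth; congr ereal_sup; apply: eq_imagel => k _; congr (_%:E).
have -> : (0 : 'M[R[i]]_m) = 0%:M by rewrite rmorph0.
rewrite block_scalar_exp spectral_norm_block_scalar //.
(* At exponent 0 the zero block becomes the identity; its norm 1 is matched by a diagonal entry of
   [A ^+ 0], which exists because the size is [n.+1]. *)
case: k => [|k]; last by rewrite expr0n normc0 spectral_norm_ge0.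
by have := normc_le_spectral_norm (A ^+ 0) 0 0; rewrite !expr0 !mxE.
Qed.

(** The zero block contributes [z^-1] to the resolvent. A kernel vector of [A] is an eigenvector of
    the resolvent of [A] for this same [z^-1], so the new block never dominates. *)
Lemma kreiss_constant_block0 (R : realType) n m (A : 'M[R[i]]_n)
    (x : 'cV[R[i]]_n) :
  (forall z, 1 < normc z -> z%:M - A \in unitmx) -> x != 0 -> A *m x = 0 ->
  kreiss_constant (block_mx A 0 0 (0 : 'M[R[i]]_m)) = kreiss_constant A.
Proof.
move=> A_unit x0 Ax0; rewrite /kreiss_constant; congr ereal_sup.
apply: eq_imagel => z /= z1; congr ((_ * _)%:E).
have z0 : z != 0.
  by apply: contraTneq z1 => ->; rewrite normc0 ltNge ler01.
set B := invmx (z%:M - A).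
have -> : invmx (z%:M - block_mx A 0 0 0) =
          block_mx B 0 0 (z^-1%:M : 'M[R[i]]_m).
  rewrite scalar_mx_block opp_block_mx add_block_mx !oppr0 !addr0.
  set D := block_mx _ _ _ _; set E := block_mx _ _ _ _.
  have DE : D *m E = 1%:M.
    rewrite mulmx_block !mulmx0 !mul0mx !addr0 add0r mulmxV ?A_unit //.
    by rewrite -scalar_mxM mulfV // -scalar_mx_block.
  have [D_unit _] := mulmx1_unit DE.
  by rewrite -[RHS]mul1mx -(mulVmx D_unit) -mulmxA DE mulmx1.
rewrite spectral_norm_block_scalar //.
have Bx : B *m x = z^-1 *: x.
  apply: (scalerI z0); rewrite scalerA mulfV // scale1r scalemxAr.
  have -> : z *: x = (z%:M - A) *m x by rewrite mulmxBl Ax0 subr0 mul_scalar_mx.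
  by rewrite mulKmx ?A_unit.
have nx0 : 0 < norm2 x.
  by rewrite lt0r norm2_ge0 andbT; apply: contra_neq x0; exact: norm2_eq0.
by have := norm2_mulmx B x; rewrite Bx norm2Z ler_pM2r.
Qed.

(** * Fundamental symmetries and the negative index *)

Lemma fundamental_symmetry_involution (R : realType) n (J : 'M[R[i]]_n) :
  J = (J ^t*)%sesqui -> J *m J = 1%:M -> fundamental_symmetry J.
Proof.
move=> JJt JJ; have [J_unit _] := mulmx1_unit JJ; split => //.
by rewrite -[RHS]mulmx1 -JJ mulKmx.
Qed.

(** Each entry is a sign and contributes 1 in total: either 1 itself, or -1 corrected by 2. *)
Lemma sum_signs (F : fieldType) (s : seq F) :
  (-1 : F) != 1 -> {in s, forall z, z ^+ 2 = 1} ->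
  \sum_(z <- s) z + ((count_mem (-1 : F)) s).*2%:R = (size s)%:R.
Proof.
move=> N11; elim: s => [|z s IH] Hs; first by rewrite big_nil addr0.
rewrite big_cons /= -natr1 -IH => [|y ys]; last by rewrite Hs // inE ys orbT.
have /eqP := Hs z (mem_head _ _); rewrite sqrf_eq1 => /orP[/eqP ->|/eqP ->].
  by rewrite eq_sym (negPf N11) add0n -addrA addrC.
by rewrite eqxx doubleD natrD -[1.*2]/2%N; ring.
Qed.

(* The spectrum of an involution lies in {-1, 1}, so its trace determines the
   multiplicities. *)
Lemma negative_index_involution (R : realType) n (J : 'M[R[i]]_n) q :
  (0 < n)%N -> J *m J = 1%:M -> \tr J + q.*2%:R = n%:R -> negative_index J = q.
Proof.
move=> n_gt0 JJ trJ; rewrite /negative_index.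
have [s] := closed_field_poly_normal (char_poly J).
rewrite (monicP (char_poly_monic J)) scale1r => pE.
have szs : size s = n.
  by have := size_char_poly J; rewrite pE size_prod_XsubC => -[].
have s1 : {in s, forall z, z ^+ 2 = 1}.
  move=> z zs; have : eigenvalue J z.
    by rewrite eigenvalue_root_char pE root_prod_XsubC.
  case/eigenvalueP => v vJ v0; apply/eqP; rewrite -subr_eq0.
  have : (z ^+ 2 - 1) *: v == 0.
    by rewrite scalerBl scale1r expr2 -scalerA -vJ scalemxAl -vJ -mulmxA JJ
               mulmx1 subrr.
  by rewrite scaler_eq0 (negPf v0) orbF.
have N11 : (-1 : R[i]) != 1.
  by rewrite -subr_eq0 -opprD oppr_eq0 -mulr2n pnatr_eq0.
(* The trace is read off the second leading coefficient of the characteristic polynomial. *)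
have trs : \tr J = \sum_(z <- s) z.
  apply: oppr_inj; rewrite -char_poly_trace // pE -szs coefPn_prod_XsubC //.
  by rewrite szs -lt0n.
rewrite pE mu_prod_XsubC; apply/double_inj/eqP; rewrite -(eqr_nat R[i]).
by rewrite -(inj_eq (addrI (\sum_(z <- s) z))) sum_signs // -trs trJ szs.
Qed.

Lemma adjoint_block_diag (R : realType) n m (A : 'M[R[i]]_n) (B : 'M[R[i]]_m) :
  ((block_mx A 0 0 B) ^t*)%sesqui = block_mx (A ^t*)%sesqui 0 0 (B ^t*)%sesqui.
Proof. by rewrite tr_block_mx map_block_mx !trmx0 !map_mx0. Qed.

Lemma adjoint1 (R : realType) n :
  ((1%:M : 'M[R[i]]_n) ^t*)%sesqui = 1%:M.
Proof. by rewrite trmx1 map_mx1. Qed.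

(** * The flip of the basis *)

Definition flip_mx (F : fieldType) n : 'M[F]_n :=
  \matrix_(i, j) (j == rev_ord i)%:R.

Lemma mul_flip_mx (F : fieldType) n (B : 'M[F]_n) i j :
  (flip_mx F n *m B) i j = B (rev_ord i) j.
Proof.
rewrite mxE (bigD1 (rev_ord i)) //= mxE eqxx mul1r big1 ?addr0 // => k ki.
by rewrite mxE (negPf ki) mul0r.
Qed.

Lemma mulmx_flip (F : fieldType) n (B : 'M[F]_n) i j :
  (B *m flip_mx F n) i j = B i (rev_ord j).
Proof.
rewrite mxE (bigD1 (rev_ord j)) //= mxE rev_ordK eqxx mulr1.
rewrite big1 ?addr0 // => k kj.
rewrite mxE; case: eqP => [jk|_]; last by rewrite mulr0.
by rewrite jk rev_ordK eqxx in kj.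
Qed.

Lemma flip_mxK (F : fieldType) n : flip_mx F n *m flip_mx F n = 1%:M.
Proof.
by apply/matrixP => i j; rewrite mul_flip_mx !mxE rev_ordK eq_sym.
Qed.

Lemma flip_mx_adjoint (R : realType) n :
  flip_mx R[i] n = ((flip_mx R[i] n) ^t*)%sesqui.
Proof.
apply/matrixP => i j; rewrite !mxE rmorph_nat; congr (nat_of_bool _)%:R.
by rewrite eq_sym -(inj_eq rev_ord_inj) rev_ordK.
Qed.

(** The reversal fixes only the middle index [q]. In size 2q+1, trace 1 forces -1 to have
    multiplicity [q]. *)
Lemma trace_flip_mx (F : fieldType) q : \tr (flip_mx F (2 * q).+1) = 1.
Proof.
have q_lt : (q < (2 * q).+1)%N by lia.
rewrite /mxtrace (bigD1 (Ordinal q_lt)) //= mxE big1 ?addr0 => [|i iq].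
  by rewrite (_ : _ == _) //; apply/eqP/val_inj => /=; lia.
rewrite mxE; case: eqP => // /(congr1 val) /= ii.
by case/eqP: iq; apply: val_inj => /=; lia.
Qed.

(** * The scaled shift: powers, resolvent, spectrum and minimal polynomial *)

Definition scaled_shift (F : fieldType) n (g : F) : 'M[F]_n.+1 :=
  \matrix_(i, j) (g *+ (i.+1 == j :> nat)).

(** In the last row [inord i.+1] is out of range and takes its default value; the factor [i < n]
    discards that row. *)
Lemma mul_scaled_shift (F : fieldType) n (g : F) (B : 'M[F]_n.+1) i j :
  (scaled_shift n g *m B) i j = (g * B (inord i.+1) j) *+ (i < n)%N.
Proof.
rewrite mxE; case: ltnP => i_n; last first.
  rewrite big1 // => k _; rewrite mxE; case: eqP => ik; last by rewrite mul0r.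
  by have := ltn_ord k; rewrite -ik ltnS ltnNge i_n.
rewrite (bigD1 (inord i.+1)) //= mxE inordK // eqxx big1 ?addr0 // => k ki.
rewrite mxE; case: eqP => [ik|_]; last by rewrite mul0r.
by case/eqP: ki; apply: val_inj; rewrite /= inordK // ik.
Qed.

Lemma scaled_shift_exp (F : fieldType) n (g : F) k (i j : 'I_n.+1) :
  (scaled_shift n g ^+ k) i j = g ^+ k *+ (i + k == j)%N.
Proof.
elim: k i => [|k IH] i; first by rewrite expr0 mxE addn0.
rewrite exprS -mulmxE mul_scaled_shift exprS; case: ltnP => i_n.
  by rewrite IH inordK // addSnnS mulr1n mulrnAr.
by case: eqP => // ij; exfalso; have := ltn_ord j; lia.
Qed.

Lemma scaled_shift_nilpotent (F : fieldType) n (g : F) :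
  scaled_shift n g ^+ n.+1 = 0.
Proof.
apply/matrixP => i j; rewrite scaled_shift_exp mxE; case: eqP => // ij.
by exfalso; have := ltn_ord j; lia.
Qed.

(** The Neumann series of the resolvent, finite by nilpotency: its term of index k fills the k-th
    superdiagonal. The guard [i <= j] is needed because [j - i] truncates to 0 below the
    diagonal. *)
Definition shift_resolvent (F : fieldType) n (g z : F) : 'M[F]_n.+1 :=
  \matrix_(i, j) ((g ^+ (j - i) / z ^+ (j - i).+1) *+ (i <= j)%N).

Lemma mul_shift_resolvent (F : fieldType) n (g z : F) : z != 0 ->
  (z%:M - scaled_shift n g) *m shift_resolvent n g z = 1%:M.
Proof.
move=> z0; apply/matrixP => i j.
rewrite mulmxBl mul_scalar_mx mxE mxE [in X in _ + X]mxE mul_scaled_shift !mxE.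
case: (ltngtP i j) => ij.
- have i_n : (i < n)%N by have := ltn_ord j; lia.
  rewrite i_n inordK // ij !mulr1n (_ : (i == j) = false); last first.
    by apply: contraTF ij => /eqP ->; rewrite ltnn.
  (* Above the diagonal two consecutive terms of the series cancel; the exponents are written
     relative to the smaller one. *)
  have -> : (j - i = (j - i.+1).+1)%N by lia.
  set k := (j - i.+1)%N; rewrite (exprS g) (exprS z k.+1) invfM.
  by rewrite mulr0n; field; rewrite ?expf_neq0 ?z0.
- rewrite (_ : (i == j) = false); last first.
    by apply: contraTF ij => /eqP ->; rewrite ltnn.
  case: ltnP => i_n /=; last by rewrite !mulr0n mulr0 subr0.
  rewrite inordK // (_ : (i < j)%N = false) ?mulr0n ?mulr0 ?subr0 //.
  by apply/negbTE; rewrite -leqNgt ltnW.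
have -> : i = j by apply: val_inj.
rewrite eqxx subnn expr0 expr1 div1r mulr1n divff // mulr1n.
case: ltnP => j_n /=; last by rewrite mulr0n subr0.
by rewrite inordK // ltnn mulr0 mul0rn subr0.
Qed.

Lemma scaled_shift_resolvent (F : fieldType) n (g z : F) : z != 0 ->
  z%:M - scaled_shift n g \in unitmx /\
  invmx (z%:M - scaled_shift n g) = shift_resolvent n g z.
Proof.
move=> z0; have DE := mul_shift_resolvent n g z0.
have [D_unit _] := mulmx1_unit DE; split => //.
by rewrite -[RHS](mulKmx D_unit) DE mulmx1.
Qed.

(** Supplies the kernel vector required by [kreiss_constant_block0]. *)
Lemma scaled_shift_delta0 (F : fieldType) n (g : F) :
  scaled_shift n g *m (delta_mx 0 0 : 'cV[F]_n.+1) = 0.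
Proof.
rewrite -colE; apply/matrixP => i j; rewrite !mxE.
by case: eqP.
Qed.

Lemma spectrum_scaled_shift (R : realType) n (g : R[i]) :
  spectrum (scaled_shift n g) = [set 0].
Proof.
apply/seteqP; split => z /=.
  case/eigenvalueP => v vA v0.
  have vAk k : v *m scaled_shift n g ^+ k = z ^+ k *: v.
    elim: k => [|k IH]; first by rewrite !expr0 mulmx1 scale1r.
    by rewrite exprSr -mulmxE mulmxA IH -scalemxAl vA scalerA -exprSr.
  have /esym/eqP := vAk n.+1; rewrite scaled_shift_nilpotent mulmx0.
  by rewrite scaler_eq0 (negPf v0) orbF expf_eq0 => /andP[_ /eqP].
(* For row vectors the kernel is reached by the last basis vector, since the last row of the shift
   is zero. *)
move=> ->; apply/eigenvalueP; exists (delta_mx 0 ord_max).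
  rewrite scale0r -rowE; apply/matrixP => i j; rewrite !mxE.
  by case: eqP => // nj; have := ltn_ord j; rewrite -nj ltnn.
by apply/eqP => /matrixP /(_ 0 ord_max) /eqP; rewrite !mxE !eqxx oner_eq0.
Qed.

(* The first basis vector is cyclic for the shift, so a polynomial of degree at
   most n annihilating it vanishes. *)
Lemma minpoly_degree_scaled_shift (R : realType) n (g : R[i]) : g != 0 ->
  minpoly_degree (scaled_shift n g) = n.+1.
Proof.
move=> g0; rewrite /minpoly_degree; set p := mxminpoly _.
have p_monic : p \is monic := mxminpoly_monic _.
have p_neq0 : p != 0 := monic_neq0 p_monic.
apply/eqP; rewrite eqn_leq; apply/andP; split.
  have /dvdp_leq := mxminpoly_dvd_char (scaled_shift n g).
  rewrite monic_neq0 ?char_poly_monic // size_char_poly -/p => /(_ isT).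
  by case: (size p).
rewrite leqNgt; apply/negP => size_p.
case/eqP: p_neq0; apply/polyP => k; rewrite coef0.
have [k_n|k_n] := ltnP k n.+1; last first.
  rewrite nth_default //; apply: leq_trans k_n.
  by move: size_p; case: (size p).
(* In row 0 of [p] evaluated at the shift, column [k] receives only the term of degree [k], namely
   the coefficient of [p] times [g ^+ k]. *)
have /matrixP /(_ 0 (Ordinal k_n)) := mx_root_minpoly (scaled_shift n g).
rewrite -/p -{1}(coefK p) poly_def linear_sum summxE /= mxE.
under eq_bigr => i _ do
  rewrite linearZ rmorphXn /= horner_mx_X mxE scaled_shift_exp add0n.
have [k_p|k_p] := ltnP k (size p); last by rewrite nth_default.
rewrite (bigD1 (Ordinal k_p)) //= eqxx big1 => [|i ik].
  rewrite addr0 mulr1n => /eqP.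
  by rewrite mulf_eq0 expf_eq0 (negPf g0) andbF orbF => /eqP.
rewrite (_ : (i == k :> nat) = false) ?mulr0 //.
by apply: contraNF ik => /eqP ik; apply/eqP/val_inj.
Qed.

(** Both products have the entry [g] exactly where [i + j = n.+1], and zeros elsewhere. *)
Lemma J_selfadjoint_scaled_shift (R : realType) n (g : R[i]) : g^* = g ->
  J_selfadjoint (flip_mx R[i] n.+1) (scaled_shift n g).
Proof.
move=> gg; apply/matrixP => i j; rewrite mulmx_flip mul_flip_mx !mxE.
rewrite rmorphMn /= gg; congr (_ *+ (nat_of_bool _)); apply/eqP/eqP => /=;
  by have := ltn_ord i; have := ltn_ord j; lia.
Qed.

(** * Power growth and Kreiss constant of the scaled shift *)

(** Isolates one dominant entry in the entry sum; it is applied to the top right corner of powers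
    and resolvents. *)
Lemma spectral_norm_le_entry (R : realType) n (A : 'M[R[i]]_n) i0 j0 (a b : R) :
  0 <= b -> normc (A i0 j0) <= a ->
  (forall i j, (i, j) != (i0, j0) -> normc (A i j) <= b) ->
  spectral_norm A <= a + (n ^ 2)%:R * b.
Proof.
move=> b0 Aa Ab; apply: le_trans (spectral_norm_le_sum A) _.
rewrite pair_big /= (bigD1 (i0, j0)) //=; apply: lerD => //.
apply: (@le_trans _ _ (\sum_(p : 'I_n * 'I_n | p != (i0, j0)) b)).
  by apply: ler_sum => -[i j] /Ab.
rewrite sumr_const mulr_natl; apply: ler_wpMn2l => //.
by apply: leq_trans (max_card _) _; rewrite card_prod !card_ord.
Qed.

(** The m-th power has only its corner entry, and later powers vanish. Earlier powers have entries
    of modulus at most [normc g ^+ m.-1], and the lower bound on [normc g] absorbs the number of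
    entries. *)
Lemma power_growth_scaled_shift (R : realType) m (g : R[i]) : (0 < m)%N ->
  (m.+1 ^ 2)%:R <= normc g ->
  power_growth (scaled_shift m g) = (normc g ^+ m)%:E.
Proof.
move=> m_gt0 gm.
have g1 : 1 <= normc g by apply: le_trans gm; rewrite ler1n expn_gt0.
have g0 : 0 <= normc g by apply: le_trans g1.
apply/eqP; rewrite eq_le; apply/andP; split; last first.
  apply: le_trans (ereal_sup_ubound _); last by exists m.
  rewrite lee_fin -normcX.
  have := normc_le_spectral_norm (scaled_shift m g ^+ m) ord0 ord_max.
  by rewrite scaled_shift_exp eqxx.
apply: ge_ereal_sup => _ [k _ <-]; rewrite lee_fin.
have entry0 b : normc (g ^+ k *+ (b : bool)) <= normc g ^+ k.
  by case: b; rewrite ?normcX // mulr0n normc0 exprn_ge0.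
case: (ltngtP k m) => km.
- have gk : normc g ^+ k <= normc g ^+ m.-1 by apply: ler_weXn2l => //; lia.
  apply: (@le_trans _ _ (0 + (m.+1 ^ 2)%:R * normc g ^+ m.-1)).
    apply: (spectral_norm_le_entry (i0 := ord0) (j0 := ord_max)).
    + by rewrite exprn_ge0.
    + rewrite scaled_shift_exp /= add0n (ltn_eqF km) mulr0n.
      by rewrite normc0.
    + by move=> i j _; rewrite scaled_shift_exp; apply: le_trans gk.
  by rewrite add0r -[in leRHS](prednK m_gt0) exprS ler_wpM2r ?exprn_ge0.
- have -> : scaled_shift m g ^+ k = 0.
    by rewrite -(subnK km) exprD scaled_shift_nilpotent mulr0.
  apply: spectral_norm_le => x _; rewrite mul0mx norm2_0 exprn_ge0 //.
rewrite -[leRHS]addr0 -(mulr0 (m.+1 ^ 2)%:R).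
apply: (spectral_norm_le_entry (i0 := ord0) (j0 := ord_max)) => //.
  by rewrite scaled_shift_exp -km entry0.
move=> i j ij; rewrite scaled_shift_exp; case: eqP => ikj; last first.
  by rewrite mulr0n normc0.
case/eqP: ij; have := ltn_ord j => jm.
by congr (_, _); apply: val_inj => /=; lia.
Qed.

Lemma bernoulli_ineq (R : realFieldType) (x : R) k : -1 <= x ->
  1 + k%:R * x <= (1 + x) ^+ k.
Proof.
move=> x1; elim: k => [|k IH]; first by rewrite expr0 mul0r addr0.
rewrite exprS; apply: le_trans (_ : (1 + x) * (1 + k%:R * x) <= _); last first.
  by rewrite ler_wpM2l //; lra.
have k0 : 0 <= k%:R :> R by [].
by have := mulr_ge0 k0 (sqr_ge0 x); rewrite -natr1 expr2; lra.
Qed.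

Definition kreiss_coef (R : realFieldType) m : R :=
  m%:R ^+ m / m.+1%:R ^+ m.+1.

(* The coefficient is the maximum of (r - 1) / r^(m+1), attained at
   r = (m + 1) / m. *)
Lemma kreiss_coef_max (R : realFieldType) m (r : R) : (0 < m)%N -> 1 < r ->
  (r - 1) / r ^+ m.+1 <= kreiss_coef R m.
Proof.
move=> m_gt0 r1; rewrite /kreiss_coef.
have r0 : 0 < r by apply: lt_trans r1.
have m0 : 0 < m%:R :> R by rewrite ltr0n.
have m10 : 0 < m.+1%:R :> R by [].
rewrite ler_pdivrMr ?exprn_gt0 // mulrAC ler_pdivlMr ?exprn_gt0 //.
(* Bernoulli's inequality with 1 + x = m r / (m + 1) and exponent m + 1 has left side m (r - 1);
   clearing denominators gives the claim. *)
have x1 : -1 <= m%:R * r / m.+1%:R - 1.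
  by rewrite lerDr divr_ge0 ?mulr_ge0 // ltW.
have := bernoulli_ineq m.+1 x1.
have -> : 1 + m.+1%:R * (m%:R * r / m.+1%:R - 1) = m%:R * (r - 1).
  by rewrite -natr1; field; rewrite ?nat1r ?natr1 gt_eqF.
rewrite [1 + _]addrC subrK expr_div_n exprMn exprS ler_pdivlMr ?exprn_gt0 //.
by rewrite -!mulrA ler_pM2l.
Qed.

(** The corner of the resolvent gives the main term through [kreiss_coef_max]. Every other entry is
    at most |g|^(m-1) / |z|, and (|z| - 1) / |z| is at most 1. *)
Lemma kreiss_constant_scaled_shift_le (R : realType) m (g : R[i]) :
  (0 < m)%N -> 1 <= normc g ->
  (kreiss_constant (scaled_shift m g) <=
    (normc g ^+ m * kreiss_coef R m
      + (m.+1 ^ 2)%:R * normc g ^+ m.-1)%:E)%E.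
Proof.
move=> m_gt0 g1; have g0 : 0 <= normc g by apply: le_trans g1.
apply: ge_ereal_sup => _ [z z1 <-]; rewrite lee_fin.
have z_gt0 : 0 < normc z by apply: lt_trans z1.
have z0 : z != 0.
  by apply: contraTneq z1 => ->; rewrite normc0 ltNge ler01.
have [_ ->] := scaled_shift_resolvent m g z0.
have r1 : 0 <= normc z - 1 by rewrite subr_ge0 ltW.
have entryE d : normc (g ^+ d / z ^+ d.+1) = normc g ^+ d / normc z ^+ d.+1.
  by rewrite normcM normcV !normcX.
apply: le_trans (ler_wpM2l r1 (spectral_norm_le_entry (i0 := ord0)
  (j0 := ord_max) (a := normc g ^+ m / normc z ^+ m.+1)
  (b := normc g ^+ m.-1 / normc z) _ _ _)) _.
- by rewrite divr_ge0 ?exprn_ge0 // ltW.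
- by rewrite mxE /= subn0 mulr1n entryE.
- move=> i j ij; rewrite mxE; case: leqP => [ij_le|_]; last first.
    by rewrite mulr0n normc0 divr_ge0 ?exprn_ge0 // ltW.
  (* The distance [m] from the diagonal occurs only at the excluded corner. *)
  have d_m : (j - i <= m.-1)%N.
    have jm := ltn_ord j; have [i0|i0] := posnP i; last by lia.
    rewrite i0 subn0 -ltnS prednK // ltn_neqAle -ltnS jm andbT.
    apply: contra ij => /eqP jm'; apply/eqP.
    by congr (_, _); apply: val_inj.
  rewrite mulr1n entryE; apply: ler_pM.
  + exact: exprn_ge0.
  + by rewrite invr_ge0 exprn_ge0 // ltW.
  + exact: ler_weXn2l.
  + by rewrite lef_pV2 ?posrE ?exprn_gt0 // exprS ler_peMr ?exprn_ege1 // ltW.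
rewrite mulrDr; apply: lerD.
  by rewrite mulrCA ler_wpM2l ?exprn_ge0 // kreiss_coef_max.
rewrite mulrCA ler_wpM2l // mulrCA ler_piMr ?exprn_ge0 //.
by rewrite ler_pdivrMr // mul1r gerBl.
Qed.

Lemma kreiss_constant_scaled_shift_ge (R : realType) m (g : R[i]) :
  (0 < m)%N ->
  ((normc g ^+ m * kreiss_coef R m)%:E <= kreiss_constant (scaled_shift m g))%E.
Proof.
move=> m_gt0; have m0 : 0 < m%:R :> R by rewrite ltr0n.
(* The maximiser of (r - 1) / r^(m+1): at this real point the corner entry alone yields the
   bound. *)
pose r : R := m.+1%:R / m%:R.
have r0 : 0 < r by rewrite divr_gt0.
have r1 : 1 < r by rewrite ltr_pdivlMr // mul1r ltr_nat.
have rE : normc (real_complex R r) = r by rewrite normc_real gtr0_norm.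
apply: le_trans (ereal_sup_ubound _); last first.
  by exists (real_complex R r); [rewrite /mkset rE|reflexivity].
have z0 : real_complex R r != 0.
  apply: contraTneq r1 => r_eq0.
  by rewrite -rE r_eq0 normc0 ltNge ler01.
have [_ ->] := scaled_shift_resolvent m g z0.
rewrite lee_fin rE.
have := normc_le_spectral_norm (shift_resolvent m g (real_complex R r))
  ord0 ord_max.
rewrite mxE /= subn0 mulr1n normcM normcV !normcX rE.
have r10 : 0 <= r - 1 by rewrite subr_ge0 ltW.
move=> /(ler_wpM2l r10); apply: le_trans; rewrite [leRHS]mulrCA.
rewrite le_eqVlt; apply/orP; left; apply/eqP; congr (_ * _).
rewrite /kreiss_coef /r expr_div_n exprS -natr1.
by rewrite (exprS m%:R m); field; rewrite ?nat1r ?natr1 ?expf_neq0 ?gt_eqF.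
Qed.

(** * Limit of the ratio, and the extended pair *)

(** The middle term is e (m / (m + 1))^m. Both bounds come from 1 + x <= exp x, at x = 1 / m for the
    lower one and x = -1 / (m + 1) for the upper one. *)
Lemma kreiss_coef_bounds (R : realType) m : (0 < m)%N ->
  1 <= expR 1 * m.+1%:R * kreiss_coef R m <= expR (m.+1%:R^-1).
Proof.
move=> m_gt0; have m0 : 0 < m%:R :> R by rewrite ltr0n.
have coefE : m.+1%:R * kreiss_coef R m = (m%:R / m.+1%:R) ^+ m.
  rewrite /kreiss_coef expr_div_n exprS; field.
  by rewrite ?nat1r ?natr1 ?expf_neq0 ?gt_eqF.
rewrite -mulrA coefE; apply/andP; split.
  rewrite -(invf_div m.+1%:R) exprVn ler_pdivlMr ?exprn_gt0 ?divr_gt0 // mul1r.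
  have -> : expR 1 = expR (m%:R^-1) ^+ m :> R.
    by rewrite -expRM_natl mulfV ?gt_eqF.
  rewrite lerXn2r ?nnegrE ?divr_ge0 ?expR_ge0 //.
  apply: le_trans (expR_ge1Dx _).
  by rewrite -natr1 mulrDl mul1r divff ?gt_eqF // addrC.
apply: (@le_trans _ _ (expR 1 * expR (- m.+1%:R^-1) ^+ m)).
  rewrite ler_wpM2l ?expR_ge0 // lerXn2r ?nnegrE ?divr_ge0 ?expR_ge0 //.
  apply: le_trans (expR_ge1Dx _).
  rewrite le_eqVlt; apply/orP; left; apply/eqP.
  by rewrite -natr1; field; rewrite ?nat1r ?natr1 gt_eqF.
rewrite -expRM_natl -expRD ler_expR le_eqVlt; apply/orP; left; apply/eqP.
by rewrite -natr1; field; rewrite ?nat1r ?natr1 gt_eqF.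
Qed.

Lemma kreiss_ratio_bounds (R : realType) m : (0 < m)%N ->
  ((expR (m.+1%:R^-1) + expR 1 / m.+1%:R)^-1%:E
    <= kreiss_ratio m.+1 (scaled_shift m ((m.+1 ^ 4)%:R : R[i])) <= 1)%E.
Proof.
move=> m_gt0; set g : R[i] := _%:R; set n : R := m.+1%:R.
have n_gt0 : 0 < n by [].
have gE : normc g = n ^+ 4.
  by rewrite -natrX -[RHS]normr_nat -normc_real rmorph_nat.
have g_gt0 : 0 < normc g by rewrite gE exprn_gt0.
have g1 : 1 <= normc g by rewrite gE exprn_ege1 // ler1n.
have M_eq : power_growth (scaled_shift m g) = (normc g ^+ m)%:E.
  apply: power_growth_scaled_shift => //.
  by rewrite gE -natrX ler_nat leq_exp2l.
have K_le := kreiss_constant_scaled_shift_le m_gt0 g1.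
have K_ge := kreiss_constant_scaled_shift_ge g m_gt0.
rewrite /kreiss_ratio M_eq.
(* The two bounds exclude infinite values, so the rest is real arithmetic. *)
case: (kreiss_constant _) K_le K_ge => [k||] //; rewrite !lee_fin.
have [coef_ge coef_le] := andP (kreiss_coef_bounds R m_gt0).
rewrite -/n in coef_ge coef_le; set c := kreiss_coef R m in coef_ge coef_le *.
set G := normc g ^+ m => k_le k_ge.
have G_gt0 : 0 < G by rewrite exprn_gt0.
have e_gt0 : 0 < expR 1 :> R := expR_gt0 1.
have en_gt0 : 0 < expR 1 * n by rewrite mulr_gt0.
have enk_ge : G <= expR 1 * n * k.
  apply: le_trans (_ : expR 1 * n * (G * c) <= _); last by rewrite ler_pM2l.
  by rewrite mulrCA ler_peMr // ltW.
(* Here the exponent 4 in [g] matters: after multiplication by e n the tail is still only e / n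
   relative to [G]. *)
have tailE : (m.+1 ^ 2)%:R * normc g ^+ m.-1 = G / n ^+ 2.
  rewrite /G -[in RHS](prednK m_gt0) exprS gE natrX -/n.
  by field; rewrite gt_eqF.
have enk_le : expR 1 * n * k <= G * (expR n^-1 + expR 1 / n).
  apply: le_trans (_ : expR 1 * n * (G * c + G / n ^+ 2) <= _).
    by rewrite ler_pM2l // -tailE.
  have -> : expR 1 * n * (G * c + G / n ^+ 2) =
            G * (expR 1 * n * c + expR 1 / n) by field; rewrite gt_eqF.
  by rewrite ler_pM2l // lerD2r.
have enk_gt0 : 0 < expR 1 * n * k := lt_le_trans G_gt0 enk_ge.
rewrite -EFinM inver gt_eqF // -EFinM !lee_fin; apply/andP; split; last first.
  by rewrite ler_pdivrMr // mul1r.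
rewrite ler_pdivlMr // mulrC ler_pdivrMr ?addr_gt0 ?expR_gt0 ?divr_gt0 //.
Qed.

Lemma kreiss_ratio_cvg (R : realType) :
  kreiss_ratio (2 * q).+1
    (scaled_shift (2 * q) (((2 * q).+1 ^ 4)%:R : R[i])) @[q --> \oo] --> 1%:E.
Proof.
(* The lower bound is weakened from 2q+1 to q+1, so that its limit follows from the harmonic
   sequence. *)
pose f q : R := (expR q.+1%:R^-1 + expR 1 * q.+1%:R^-1)^-1.
have f_cvg : (f q)%:E @[q --> \oo] --> 1%:E.
  apply: cvg_EFin; first exact: nearW.
  have -> : (1 : R) = (expR 0 + expR 1 * 0)^-1.
    by rewrite mulr0 addr0 expR0 invr1.
  have h0 : q.+1%:R^-1 @[q --> \oo] --> (0 : R) by exact: cvg_harmonic.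
  apply: cvgV; first by rewrite mulr0 addr0 expR0 oner_eq0.
  apply: cvgD; last exact: cvgMl_tmp.
  by apply: continuous_cvg h0; exact: continuous_expR.
apply: (squeeze_cvge _ f_cvg (cvg_cst _)).
exists 1%N => // q /= q_gt0.
have m_gt0 : (0 < 2 * q)%N by lia.
have [H1 ->] := andP (kreiss_ratio_bounds R m_gt0); rewrite andbT.
apply: le_trans H1; rewrite lee_fin lef_pV2 ?posrE; last 2 first.
- by rewrite addr_gt0 ?expR_gt0 // mulr_gt0 ?expR_gt0.
- by rewrite addr_gt0 ?expR_gt0 // mulr_gt0 ?expR_gt0.
have h : (2 * q).+1%:R^-1 <= q.+1%:R^-1 :> R.
  by rewrite lef_pV2 ?posrE // ler_nat; lia.
by rewrite lerD ?ler_expR // ler_wpM2l ?expR_ge0.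
Qed.

(* A is extended by a zero block, and J by an identity block, which has no
   eigenvalue -1. *)
Lemma extend_pair (R : realType) q N (g : R[i]) (n := (2 * q).+1)
    (J := flip_mx R[i] n) (A := scaled_shift (2 * q) g) :
  g^* = g -> (n <= N)%N ->
  exists p : 'M[R[i]]_N * 'M[R[i]]_N,
    [/\ fundamental_symmetry p.1 /\ negative_index p.1 = q,
        J_selfadjoint p.1 p.2,
        extends J p.1 /\ extends A p.2,
        power_growth p.2 = power_growth A
      & kreiss_constant p.2 = kreiss_constant A].
Proof.
(* Once [N] is literally [n + m], the cast in [extends] is along [erefl]. *)
move=> gg /subnKC; set m := (N - n)%N => eN; clearbody m; subst N.
exists (block_mx J 0 0 1%:M, block_mx A 0 0 0); split => /=.
- have JJ : block_mx J 0 0 (1%:M : 'M[R[i]]_m) *m block_mx J 0 0 1%:M = 1%:M.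
    rewrite mulmx_block !mulmx0 !mul0mx !addr0 add0r mul1mx flip_mxK.
    by rewrite -scalar_mx_block.
  split; last first.
    apply: negative_index_involution => //.
    (* The identity block adds [m] to the trace and to the size, so the count [q] is unchanged. *)
    rewrite mxtrace_block trace_flip_mx mxtrace1 -(natrD _ 1) -natrD.
    by congr (_%:R); rewrite /n; lia.
  apply: fundamental_symmetry_involution => //.
  by rewrite adjoint_block_diag adjoint1 -flip_mx_adjoint.
- rewrite /J_selfadjoint adjoint_block_diag !mulmx_block trmx0 map_mx0.
  rewrite !mulmx0 !mul0mx !addr0.
  by rewrite [X in block_mx X](J_selfadjoint_scaled_shift _ gg).
- by split; [exists m, erefl, 1%:M|exists m, erefl, 0].
- exact: power_growth_block0.
apply: (@kreiss_constant_block0 _ _ _ _ (delta_mx 0 0)).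
- move=> z z1; have z0 : z != 0.
    by apply: contraTneq z1 => ->; rewrite normc0 ltNge ler01.
  by have [] := scaled_shift_resolvent (2 * q) g z0.
- by apply/eqP => /matrixP /(_ 0 0) /eqP; rewrite !mxE oner_eq0.
- exact: scaled_shift_delta0.
Qed.

Theorem theorem5p1 (R : realType) :
  exists (J A : forall q : nat, 'M[R[i]]_((2 * q).+1)),
    [/\ (forall q : nat, (1 <= q)%N ->
          [/\ fundamental_symmetry (J q), negative_index (J q) = q,
              J_selfadjoint (J q) (A q), spectrum (A q) = [set 0]
            & minpoly_degree (A q) = (2 * q).+1]),
        kreiss_ratio (2 * q).+1 (A q) @[q --> \oo] --> 1%:E
      & exists (J' A' : forall q N : nat, 'M[R[i]]_N),
          (forall q N : nat, (1 <= q)%N -> ((2 * q).+1 <= N)%N ->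
            [/\ fundamental_symmetry (J' q N) /\ negative_index (J' q N) = q,
                J_selfadjoint (J' q N) (A' q N),
                extends (J q) (J' q N) /\ extends (A q) (A' q N),
                power_growth (A' q N) = power_growth (A q)
              & kreiss_constant (A' q N) = kreiss_constant (A q)]) /\
          (forall Nseq : nat -> nat,
            (forall q : nat, (1 <= q)%N -> ((2 * q).+1 <= Nseq q)%N) ->
            kreiss_ratio (2 * q).+1 (A' q (Nseq q)) @[q --> \oo] --> 1%:E)].
Proof.
pose g q : R[i] := ((2 * q).+1 ^ 4)%:R.
pose J q := flip_mx R[i] (2 * q).+1; pose A q := scaled_shift (2 * q) (g q).
have gg q : (g q)^* = g q by exact: rmorph_nat.
have g0 q : g q != 0 by rewrite pnatr_eq0 expn_eq0.
exists J, A; split.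
- move=> q _; split.
  + exact: fundamental_symmetry_involution (flip_mx_adjoint _ _) (flip_mxK _ _).
  + apply: negative_index_involution => //; first exact: flip_mxK.
    by rewrite trace_flip_mx -mul2n nat1r.
  + exact: J_selfadjoint_scaled_shift.
  + exact: spectrum_scaled_shift.
  + exact: minpoly_degree_scaled_shift.
- exact: kreiss_ratio_cvg.
(* The size condition sits under the existential, with the default pair [(0, 0)] when it fails, so
   that choice yields functions total in [q] and [N]. *)
have ext q N : exists p : 'M[R[i]]_N * 'M[R[i]]_N, ((2 * q).+1 <= N)%N ->
    [/\ fundamental_symmetry p.1 /\ negative_index p.1 = q,
        J_selfadjoint p.1 p.2,
        extends (J q) p.1 /\ extends (A q) p.2,
        power_growth p.2 = power_growth (A q)
      & kreiss_constant p.2 = kreiss_constant (A q)].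
  case: (leqP (2 * q).+1 N) => [qN|_]; last by exists (0, 0).
  by have [p Hp] := extend_pair (gg q) qN; exists p.
pose P q N := sval (cid (ext q N)).
have PP q N := svalP (cid (ext q N)); rewrite -/(P _ _) in PP.
exists (fun q N => (P q N).1), (fun q N => (P q N).2); split.
  by move=> q N _; exact: PP.
move=> Nseq Nseq_ge; apply: cvg_trans (@kreiss_ratio_cvg R).
(* The ratio depends on the matrix only through the two preserved constants, so both sequences agree
   from q = 1 on. *)
apply: near_eq_cvg; exists 1%N => // q /= q_gt0.
have [_ _ _ M_eq K_eq] := PP q _ (Nseq_ge q q_gt0).
rewrite /kreiss_ratio [power_growth (P _ _).2]M_eq.
by rewrite [kreiss_constant (P _ _).2]K_eq.
Qed.
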